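(* Let ${\bf E}$ be an $n$-dimensional nilpotent evolution algebra over $\mathbb K$ with maximal index of nilpotency, with fixed natural basis $\{{\bf e}_1,\dots,{\bf e}_n\}$ in normal form, and let $R$ be a Rota-Baxter operator of weight $\theta=0$ on ${\bf E}$, with matrix $(r_{i,j})_{i,j=1}^n$ given by $R({\bf e}_i)=\sum_{k=1}^n r_{i,k}{\bf e}_k$. Then $r_{i,j}=0$ for every $i<j<n$.
   Context: $\mathbb K$ is $\mathbb R$ or $\mathbb C$. An evolution algebra over $\mathbb K$ is a vector space ${\bf E}$ with a bilinear multiplication and a basis $\{{\bf e}_i\}$ (a natural basis) such that ${\bf e}_i{\bf e}_j={\bf 0}$ for $i\ne j$ (and ${\bf e}_i^2$ is a linear combination of basis vectors). ''Nilpotent with maximal index of nilpotency'' means ${\bf E}$ is nilpotent with $\dim({\bf E}\cdot{\bf E})=n-1$; throughout, for such ${\bf E}$ a natural basis in normal form is fixed, meaning ${\bf e}_i^2=\sum_{j=i+1}^{n}a_{i,j}{\bf e}_j$ for $i<n$ and ${\bf e}_n^2={\bf 0}$, where $a_{i,j}\in\mathbb K$, $a_{i,i+1}=1$ for all $i<n$, and $a_{i,n}=0$ for all $i\le n-2$. A linear map $R:{\bf E}\to{\bf E}$ is a Rota-Baxter operator of weight $\theta$ if $R({\bf x})R({\bf y})=R(R({\bf x}){\bf y}+{\bf x}R({\bf y})+\theta{\bf x}{\bf y})$ for all ${\bf x},{\bf y}\in{\bf E}$. *)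

(* Defs.v *)
From HB Require Import structures.
From mathcomp Require Import all_boot all_order all_algebra.
From mathcomp Require Import reals complex.

Set Implicit Arguments.
Unset Strict Implicit.
Unset Printing Implicit Defensive.

Import GRing.Theory.
Local Open Scope ring_scope.

Inductive scalar_kind := RealScalars | ComplexScalars.

(* "K is the field of real or of complex numbers" *)
Definition scalars (R : realType) (k : scalar_kind) : fieldType :=
  match k with
  | RealScalars => R
  | ComplexScalars => R[i]
  end.

Section EvolutionAlgebra.
Variables (K : fieldType) (E : vectType K) (mul : {bilinear E -> E -> E}).

(* An evolution algebra is an algebra (E, mul), not assumed associative or
   commutative, together with such an e. *)
Definition natural_basis (n : nat) (e : n.-tuple E) : Prop :=
  basis_of fullv e /\ forall i j : 'I_n, i != j -> mul e`_i e`_j = 0.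

(* The product U.V of two subspaces: the span of all u v, u in U, v in V. *)
Definition mul_vspace (U V : {vspace E}) : {vspace E} :=
  <<[seq mul u v | u <- vbasis U, v <- vbasis V]>>%VS.

Lemma mul_vspaceP (U V W : {vspace E}) :
  reflect (forall u v, u \in U -> v \in V -> mul u v \in W)
          (mul_vspace U V <= W)%VS.
Proof.
apply: (iffP span_subvP) => [sW u v Uu Vv | sW _ /allpairsP[[u v] /= [Uu Vv ->]]].
  rewrite (coord_vbasis Uu) (coord_vbasis Vv) linear_sumlz rpred_sum // => i _.
  rewrite linear_sumr rpred_sum // => j _; rewrite linearZl_LR linearZr_LR /=.
  by rewrite !rpredZ // sW //; apply: allpairs_f; rewrite mem_nth ?size_tuple.
by apply: sW; apply: vbasis_mem.
Qed.

(* The sequence E^1, ..., E^(m+1), where E^1 = E and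
   E^k = E^1.E^(k-1) + E^2.E^(k-2) + ... + E^(k-1).E^1. *)
Fixpoint alg_powers (m : nat) : seq {vspace E} :=
  if m is m'.+1 then
    let s := alg_powers m' in
    rcons s (\sum_(i < m) mul_vspace (nth 0%VS s i) (nth 0%VS s (m' - i)))%VS
  else [:: fullv].

(* Note the shift: alg_power m is E^(m+1). *)
Definition alg_power (m : nat) : {vspace E} := nth 0%VS (alg_powers m) m.

Lemma size_alg_powers m : size (alg_powers m) = m.+1.
Proof. by elim: m => //= m IHm; rewrite size_rcons IHm. Qed.

Lemma nth_alg_powers m i :
  (i <= m)%N -> nth 0%VS (alg_powers m) i = alg_power i.
Proof.
elim: m => [|m IHm]; first by rewrite leqn0 => /eqP->.
rewrite leq_eqVlt => /predU1P[-> // | lt_im].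
by rewrite /= nth_rcons size_alg_powers lt_im IHm.
Qed.

Lemma alg_power0 : alg_power 0 = fullv.
Proof. by []. Qed.

Lemma alg_powerS m :
  alg_power m.+1 =
    (\sum_(i < m.+1) mul_vspace (alg_power i) (alg_power (m - i)))%VS.
Proof.
rewrite {1}/alg_power /= nth_rcons size_alg_powers ltnn eqxx.
by apply: eq_bigr => i _; rewrite !nth_alg_powers ?leq_subr // -ltnS.
Qed.

Definition nilpotent_alg : Prop := exists m, alg_power m = 0%VS.

(* \dim (E.E) = n - 1 with n = \dim E; the successor form avoids the
   truncated predecessor, hence excludes E = 0. *)
Definition max_nilpotent : Prop :=
  nilpotent_alg /\
  (\dim (mul_vspace fullv fullv)).+1 = \dim (fullv : {vspace E}).

(* The basis e_1, ..., e_n is indexed here by i = 0, ..., n - 1. *)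
Definition normal_form (n : nat) (e : n.-tuple E) (a : 'M[K]_n) : Prop :=
  [/\ forall i : 'I_n, (i.+1 < n)%N ->
        mul e`_i e`_i = \sum_(j < n | (i < j)%N) a i j *: e`_j,
      forall i : 'I_n, i.+1 = n -> mul e`_i e`_i = 0,
      forall i j : 'I_n, j = i.+1 :> nat -> a i j = 1
    & forall i j : 'I_n, (i.+2 < n)%N -> j.+1 = n -> a i j = 0].

Definition rota_baxter (theta : K) (f : E -> E) : Prop :=
  forall x y, mul (f x) (f y) = f (mul (f x) y + mul x (f y) + theta *: mul x y).

Definition matrix_in_basis (n : nat) (e : n.-tuple E) (f : E -> E)
    (r : 'M[K]_n) : Prop :=
  forall i : 'I_n, f e`_i = \sum_(k < n) r i k *: e`_k.

End EvolutionAlgebra.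

(* Main.v *)
Require Import Defs.
From mathcomp Require Import all_boot all_order all_algebra.
From mathcomp Require Import reals.
From mathcomp Require Import zify.

(** Filter the algebra by the subspaces W_m of vectors whose first m
    coordinates vanish.  Since e_k^2 = e_(k+1) + (later terms), the product of
    x and y is the sum of the x_k y_k e_k^2, and these squares are triangular.
    Hence the product determines the first n - 1 of the numbers x_k y_k, and it
    lies in W_(m+1), for m < n, exactly when x_k y_k = 0 for all k < m
    ([lead_mul], [mul_ord_geS], [mul_ord_geS_inv]).

    In weight 0, f x * f x = f (f x * x + x * f x).  If x is in W_m, then the
    argument of f on the right is in W_(m+1), so, by descending induction on m,
    (f x)_k ^ 2 = 0 for k < m: f preserves the filtration
    ([rota_baxter_ord_ge]).  Thus f is triangular, with diagonal entries
    l_0, ..., l_(n-1), and l_m is the factor by which f acts on leading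
    coefficients of vectors in W_m.

    Comparing leading coefficients in the identity for (e_i, e_i) gives
    l_i ^ 2 = 2 l_i l_(i+1).  If l_i = 0, then e_i * f e_i = 0, so f e_i has
    square zero and is a multiple of the last basis vector.  If l_i != 0, then
    l_j = 2 l_(j+1) != 0 for all j >= i with j + 1 < n, while the leading
    coefficients in the identity for (e_i, e_j), i < j, give
    r_ij l_j = r_ij l_(j+1), that is r_ij l_(j+1) = 0. *)

Set Implicit Arguments.
Unset Strict Implicit.
Unset Printing Implicit Defensive.

Import GRing.Theory.
Local Open Scope ring_scope.

Section NormalForm.
Variables (K : fieldType) (E : vectType K) (mul : {bilinear E -> E -> E}).
Variables (n : nat) (e : n.-tuple E) (a : 'M[K]_n).
Hypothesis e_nat : natural_basis mul e.
Hypothesis e_nf : normal_form mul e a.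

Let e_basis : basis_of fullv e. Proof. by case: e_nat. Qed.
Let e_free : free e. Proof. exact: basis_free e_basis. Qed.

Lemma coord_natural_basis (i j : 'I_n) : coord e i e`_j = (j == i)%:R.
Proof. by rewrite coord_free // eq_sym. Qed.

Lemma natural_mulE x y :
  mul x y = \sum_k (coord e k x * coord e k y) *: mul e`_k e`_k.
Proof.
rewrite {1}(coord_basis e_basis (memvf x)) {1}(coord_basis e_basis (memvf y)).
rewrite linear_sumlz; apply: eq_bigr => i _.
rewrite linear_sumr (bigD1 i) //= big1 => [|j ji].
  by rewrite addr0 linearZl_LR linearZr_LR scalerA.
by rewrite linearZl_LR linearZr_LR /= (proj2 e_nat) 1?eq_sym // !scaler0.
Qed.

Lemma mul_natural_basisr x (i : 'I_n) :
  mul x e`_i = coord e i x *: mul e`_i e`_i.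
Proof.
rewrite natural_mulE (bigD1 i) //= big1 => [|j ji].
  by rewrite coord_natural_basis eqxx mulr1 addr0.
by rewrite coord_natural_basis eq_sym (negbTE ji) mulr0 scale0r.
Qed.

Lemma mul_natural_basisl x (i : 'I_n) :
  mul e`_i x = coord e i x *: mul e`_i e`_i.
Proof.
rewrite -mul_natural_basisr !natural_mulE.
by apply: eq_bigr => k _; rewrite mulrC.
Qed.

Lemma coord_sqr_le (p k : 'I_n) : (p <= k)%N -> coord e p (mul e`_k e`_k) = 0.
Proof.
move=> pk; case: e_nf => sqrE sqr0 _ _.
have [kn|nk] := ltnP k.+1 n; last first.
  by rewrite sqr0 ?linear0 //; apply/eqP; rewrite eqn_leq nk andbT.
rewrite sqrE // linear_sum big1 // => j kj.
rewrite linearZ /= coord_natural_basis.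
have -> : (j == p) = false by apply/eqP => jp; move: kj; rewrite jp; lia.
by rewrite mulr0.
Qed.

Lemma coord_sqr_succ (k k' : 'I_n) :
  k' = k.+1 :> nat -> coord e k' (mul e`_k e`_k) = 1.
Proof.
move=> kS; case: e_nf => sqrE _ a1 _.
have lt_kk' : (k < k')%N by rewrite kS.
rewrite sqrE -?kS // linear_sum (bigD1 k') //= big1 => [|j /andP[_ jk]].
  by rewrite linearZ /= coord_natural_basis eqxx a1 // mulr1 addr0.
by rewrite linearZ /= coord_natural_basis (negbTE jk) mulr0.
Qed.

Definition ord_ge (m : nat) (x : E) :=
  forall p : 'I_n, (p < m)%N -> coord e p x = 0.

Lemma ord_geD m x y : ord_ge m x -> ord_ge m y -> ord_ge m (x + y).
Proof. by move=> x0 y0 p pm; rewrite linearD /= x0 ?y0 ?addr0. Qed.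

Lemma ord_ge_basis (i : 'I_n) : ord_ge i e`_i.
Proof. by move=> p pi; rewrite coord_natural_basis -val_eqE /= gtn_eqF. Qed.

Lemma ord_ge_eq0 x : ord_ge n x -> x = 0.
Proof.
move=> x0; rewrite (coord_basis e_basis (memvf x)) big1 // => i _.
by rewrite x0 ?scale0r.
Qed.

(** The hypothesis is on the products of coordinates, so that it covers both
    x in W_m with y arbitrary and the reverse. *)
Lemma mul_ord_geS m x y :
  (forall k : 'I_n, (k < m)%N -> coord e k x * coord e k y = 0) ->
  ord_ge m.+1 (mul x y).
Proof.
move=> xy0 p pm; rewrite natural_mulE linear_sum big1 // => k _.
have [km|mk] := ltnP k m; first by rewrite xy0 // scale0r linear0.
by rewrite linearZ /= coord_sqr_le ?mulr0 //; apply: leq_trans mk.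
Qed.

Lemma lead_mul (k k' : 'I_n) x y : k' = k.+1 :> nat ->
  (forall p : 'I_n, (p < k)%N -> coord e p x * coord e p y = 0) ->
  coord e k' (mul x y) = coord e k x * coord e k y.
Proof.
move=> kS xy0; rewrite natural_mulE linear_sum (bigD1 k) //= big1 => [|p pk].
  by rewrite linearZ /= coord_sqr_succ // mulr1 addr0.
have [ltpk|lekp] := ltnP p k; first by rewrite xy0 // scale0r linear0.
rewrite linearZ /= coord_sqr_le ?mulr0 // kS ltn_neqAle lekp andbT.
by rewrite eq_sym.
Qed.

(** Triangularity of the squares is inverted one coefficient at a time: the
    bound [m < n] guarantees that each index [k < m] has a successor. *)
Lemma mul_ord_geS_inv m x y : (m < n)%N -> ord_ge m.+1 (mul x y) ->
  forall k : 'I_n, (k < m)%N -> coord e k x * coord e k y = 0.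
Proof.
move=> mn xy0 k; case: k => k kn /=.
elim/ltn_ind: k kn => k IHk kn km.
have kSn : (k.+1 < n)%N by apply: leq_ltn_trans mn.
rewrite -(@lead_mul (Ordinal kn) (Ordinal kSn)) //; first exact: xy0.
by case=> p pn /= pk; apply: IHk => //; apply: ltn_trans km.
Qed.

Section RotaBaxter.
Variable f : {linear E -> E}.
Hypothesis f_rb : rota_baxter mul 0 f.

Lemma rota_baxter0E x y : mul (f x) (f y) = f (mul (f x) y + mul x (f y)).
Proof. by rewrite f_rb scale0r addr0. Qed.

(** In the identity for the square of [f x], the argument of [f] on the right
    is one step deeper in the filtration than [x]; descending induction
    therefore bounds the square, hence [f x] itself. *)
Lemma rota_baxter_ord_ge m x : ord_ge m x -> ord_ge m (f x).
Proof.
have [d le_nd] := ubnP (n - m); elim: d m le_nd x => // d IHd m le_nd x x0.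
have [le_nm|lt_mn] := leqP n m.
  suff -> : x = 0 by rewrite linear0 => p _; rewrite linear0.
  by apply: ord_ge_eq0 => p pn; apply: x0; apply: leq_trans le_nm.
have ffx0 : ord_ge m.+1 (mul (f x) (f x)).
  rewrite rota_baxter0E; apply: IHd; first lia.
  by apply: ord_geD; apply: mul_ord_geS => k km; rewrite x0 ?mulr0 ?mul0r.
move=> p pm; apply/eqP; have := mul_ord_geS_inv lt_mn ffx0 pm.
by move/eqP; rewrite mulf_eq0 orbb.
Qed.

Definition diag_entry (i : 'I_n) : K := coord e i (f e`_i).

(** The remainder of x after its leading term lies in W_(i+1), which f
    preserves, so it does not contribute to the coordinate at i. *)
Lemma lead_rota_baxter (i : 'I_n) x :
  ord_ge i x -> coord e i (f x) = coord e i x * diag_entry i.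
Proof.
move=> x0; pose y := x - coord e i x *: e`_i.
have y0 : ord_ge i.+1 y.
  move=> p; rewrite ltnS linearB linearZ /= coord_natural_basis leq_eqVlt.
  case/predU1P => [/val_inj->|pi]; first by rewrite eqxx mulr1 subrr.
  by rewrite x0 // -val_eqE /= gtn_eqF // mulr0 subr0.
have xE : x = coord e i x *: e`_i + y by rewrite addrC subrK.
clearbody y; rewrite [in LHS]xE !linearD !linearZ /=.
by rewrite (rota_baxter_ord_ge y0 (ltnSn i)) addr0.
Qed.

Lemma coord_rota_baxter_lt (i p : 'I_n) :
  (p < i)%N -> coord e p (f e`_i) = 0.
Proof. by move=> pi; apply: rota_baxter_ord_ge pi; apply: ord_ge_basis. Qed.

(** Leading coefficients in the identity for the pair of basis vectors at
    [i] and [j], where [i <= j]; for [i < j] the term with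
    [coord e i (f e`_j)] vanishes, by triangularity. *)
Lemma rota_baxter_lead_pair (i j j' : 'I_n) :
  j' = j.+1 :> nat -> (i <= j)%N ->
  coord e j (f e`_i) * diag_entry j =
  (coord e j (f e`_i) + (coord e i (f e`_j) *+ (i == j))) * diag_entry j'.
Proof.
move=> jS le_ij.
have fj0 (x : E) (p : 'I_n) : (p < j)%N -> coord e p x * coord e p (f e`_j) = 0.
  by move=> pj; rewrite coord_rota_baxter_lt ?mulr0.
rewrite -(lead_mul jS) => [|p]; last exact: fj0.
rewrite rota_baxter0E lead_rota_baxter ?jS; last first.
  apply: ord_geD; apply: mul_ord_geS => p pj; last exact: fj0.
  by rewrite ord_ge_basis ?mulr0.
rewrite linearD /= mul_natural_basisr linearZ /= coord_sqr_succ // mulr1.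
rewrite mul_natural_basisl linearZ /=.
case: eqVneq => [->|ij]; first by rewrite coord_sqr_succ ?mulr1.
have lt_ij : (i < j)%N by rewrite ltn_neqAle ij.
by rewrite (coord_rota_baxter_lt lt_ij) mul0r.
Qed.

Lemma diag_entry_double (i i' : 'I_n) : i' = i.+1 :> nat ->
  diag_entry i != 0 -> diag_entry i = diag_entry i' + diag_entry i'.
Proof.
move=> iS l0; apply: (mulfI l0).
by rewrite {2}/diag_entry (rota_baxter_lead_pair iS) // eqxx mulrDl mulrDr.
Qed.

(** Doubling shows that a nonzero diagonal entry has a nonzero successor. *)
Lemma diag_entry_neq0 (i j : 'I_n) :
  (i <= j)%N -> diag_entry i != 0 -> diag_entry j != 0.
Proof.
case: j => j jn /=; elim: j jn => [|j IHj] jn.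
  by rewrite leqn0 => /eqP i0; rewrite (_ : Ordinal jn = i) //; apply: val_inj.
rewrite leq_eqVlt => /predU1P[ij|].
  by rewrite (_ : Ordinal jn = i) //; apply: val_inj.
rewrite ltnS => ij li; have lj := IHj (ltnW jn) ij li.
apply: contra_neq (lj) => l0.
by rewrite (@diag_entry_double _ (Ordinal jn)) // l0 addr0.
Qed.

Lemma rota_baxter_coord_eq0 (i j : 'I_n) :
  (i < j)%N -> (j.+1 < n)%N -> coord e j (f e`_i) = 0.
Proof.
move=> ij jn; have [li|li] := eqVneq (diag_entry i) 0.
  (* The products of e_i with its image vanish, so the image of e_i squares
     to zero. *)
  have sq0 : mul (f e`_i) (f e`_i) = 0.
    rewrite rota_baxter0E mul_natural_basisr (mul_natural_basisl (f _)).
    by rewrite -/(diag_entry i) li !scale0r addr0 linear0.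
  have sq_ge : ord_ge j.+2 (mul (f e`_i) (f e`_i)).
    by rewrite sq0 => p _; rewrite linear0.
  have /eqP := mul_ord_geS_inv jn sq_ge (ltnSn j).
  by rewrite mulf_eq0 orbb => /eqP.
pose j' := Ordinal jn; have jS : j' = j.+1 :> nat by [].
have lj := diag_entry_neq0 (ltnW ij) li.
have lj' := diag_entry_neq0 (leqnSn j : j <= j')%N lj.
have := rota_baxter_lead_pair jS (ltnW ij).
rewrite -val_eqE (ltn_eqF ij) mulr0n addr0.
(* The identity r_ij l_j = r_ij l_(j+1) meets l_j = 2 l_(j+1): one copy of
   r_ij l_(j+1) cancels and the other must be zero. *)
rewrite (diag_entry_double jS lj) mulrDr -[RHS]addr0 => /addrI/eqP.
by rewrite mulf_eq0 (negbTE lj') orbF => /eqP.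
Qed.

End RotaBaxter.
End NormalForm.

Theorem lemma4p3 (R : realType) (k : scalar_kind) (n : nat)
  (E : vectType (scalars R k)) (mul : {bilinear E -> E -> E})
  (e : n.-tuple E) (a : 'M[scalars R k]_n)
  (f : {linear E -> E}) (r : 'M[scalars R k]_n) :
  natural_basis mul e ->
  max_nilpotent mul ->
  normal_form mul e a ->
  rota_baxter mul 0 f ->
  matrix_in_basis e f r ->
  forall i j : 'I_n, (i < j)%N -> (j.+1 < n)%N -> r i j = 0.
Proof.
move=> e_nat _ e_nf f_rb fE i j ij jn.
rewrite -(rota_baxter_coord_eq0 e_nat e_nf f_rb ij jn) fE.
by rewrite coord_sum_free //; apply: basis_free (proj1 e_nat).
Qed.
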